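(* $\mathbf{K_N^{Krom}} \prec^w \mathbf{K_N^{Bool}}$, i.e. $\mathbf{K_N^{Krom}}$ is weakly less expressive than $\mathbf{K_N^{Bool}}$ over the class of all Kripke frames.
   Context: Fix a finite set $\tau=\{\alpha_1,\dots,\alpha_N\}$ of modality labels and a countable set $\mathcal P$ of propositional letters. Formulas of $\mathbf{K_N}$ (also written $\mathbf{K_N^{Bool}}$) are generated by $\varphi ::= \top \mid p \mid \neg\varphi \mid \varphi\vee\varphi \mid \Diamond_\alpha\varphi \mid \Box_\alpha\varphi$ ($p\in\mathcal P$, $\alpha\in\tau$); $\wedge,\rightarrow$ are abbreviations and $\bot=\neg\top$. A model $M=(W,\{R_\alpha\}_{\alpha\in\tau},V)$ has a nonempty set $W$, relations $R_\alpha\subseteq W\times W$, and valuation $V:W\to 2^{\mathcal P}$; satisfaction $M,w\Vdash\varphi$ is the standard Kripke semantics. Positive literals: $\lambda ::= \top \mid p \mid \Diamond_\alpha\lambda \mid \Box_\alpha\lambda$. A formula is in clausal form if generated by $\varphi ::= \lambda \mid \neg\lambda \mid \nabla(\neg\lambda_1\vee\dots\vee\neg\lambda_n\vee\lambda_{n+1}\vee\dots\vee\lambda_{n+m}) \mid \varphi\wedge\varphi$, where the $\lambda,\lambda_i$ are positive literals and $\nabla$ is a finite (possibly empty) sequence of boxes $\Box_{\alpha_i}\Box_{\alpha_j}\cdots$. $\mathbf{K_N^{Krom}}$ consists of clausal-form formulas in which every clause has $n+m\le 2$. Expressivity (over all Kripke frames): $\mathbf L\preceq^w\mathbf L'$ if,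 for a fixed alphabet $\mathcal P$, there is an effective translation $\varphi\mapsto\varphi'$ from $\mathbf L$-formulas over $\mathcal P$ to $\mathbf L'$-formulas over the same $\mathcal P$ such that for every model $M$ and world $w$, $M,w\Vdash\varphi$ iff $M,w\Vdash\varphi'$. $\mathbf L\equiv^w\mathbf L'$ means both $\mathbf L\preceq^w\mathbf L'$ and $\mathbf L'\preceq^w\mathbf L$; $\mathbf L\prec^w\mathbf L'$ means $\mathbf L\preceq^w\mathbf L'$ and not $\mathbf L\equiv^w\mathbf L'$. *)

(* Defs.v *)
From mathcomp Require Import all_boot.

Set Implicit Arguments.
Unset Strict Implicit.
Unset Printing Implicit Defensive.

(* Partial recursive functions of k arguments (Kleene). *)
Inductive murec : nat -> Type :=
| RZero k : murec k
| RSucc : murec 1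
| RProj k (i : 'I_k) : murec k
| RComp k m (f : murec m) (g : 'I_m -> murec k) : murec k
| RPrim k (f : murec k) (g : murec k.+2) : murec k.+1
| RMin k (f : murec k.+1) : murec k.

(* [murec_eval f v y]: the computation of f on v halts with value y. *)
Inductive murec_eval : forall k, murec k -> k.-tuple nat -> nat -> Prop :=
| EZero k (v : k.-tuple nat) : murec_eval (RZero k) v 0
| ESucc (n : nat) : murec_eval RSucc [tuple n] n.+1
| EProj k (i : 'I_k) (v : k.-tuple nat) : murec_eval (RProj i) v (tnth v i)
| EComp k m (f : murec m) (g : 'I_m -> murec k) (v : k.-tuple nat)
    (w : m.-tuple nat) (y : nat) :
    (forall i, murec_eval (g i) v (tnth w i)) ->
    murec_eval f w y -> murec_eval (RComp f g) v y
| EPrim0 k (f : murec k) (g : murec k.+2) (v : k.-tuple nat) (y : nat) :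
    murec_eval f v y -> murec_eval (RPrim f g) [tuple of 0 :: v] y
| EPrimS k (f : murec k) (g : murec k.+2) (v : k.-tuple nat) (n z y : nat) :
    murec_eval (RPrim f g) [tuple of n :: v] z ->
    murec_eval g [tuple of n :: z :: v] y ->
    murec_eval (RPrim f g) [tuple of n.+1 :: v] y
| EMin k (f : murec k.+1) (v : k.-tuple nat) (n : nat) (t : nat -> nat) :
    (forall i, i < n -> murec_eval f [tuple of i :: v] (t i).+1) ->
    murec_eval f [tuple of n :: v] 0 ->
    murec_eval (RMin f) v n.

Inductive form (N : nat) (P : Type) : Type :=
| Top
| Var (p : P)
| Neg (phi : form N P)
| Or (phi psi : form N P)
| Dia (a : 'I_N) (phi : form N P)
| Box (a : 'I_N) (phi : form N P).

Arguments Top {N P}.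
Arguments Var {N P} p.

Definition Bot {N : nat} {P : Type} : form N P := Neg Top.

Definition And (N : nat) (P : Type) (phi psi : form N P) : form N P :=
  Neg (Or (Neg phi) (Neg psi)).

Record model (N : nat) (P : Type) : Type := Model {
  world : Type;
  world_nonempty : inhabited world;
  acc : 'I_N -> world -> world -> Prop;
  val_at : world -> P -> Prop
}.

Fixpoint sat (N : nat) (P : Type) (M : model N P) (w : world M)
    (phi : form N P) : Prop :=
  match phi with
  | Top => True
  | Var p => val_at w p
  | Neg psi => ~ sat w psi
  | Or psi1 psi2 => sat w psi1 \/ sat w psi2
  | Dia a psi => exists v, acc a w v /\ sat v psi
  | Box a psi => forall v, acc a w v -> sat v psi
  end.

Fixpoint poslit (N : nat) (P : Type) (phi : form N P) : bool :=
  match phi with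
  | Top | Var _ => true
  | Dia _ psi | Box _ psi => poslit psi
  | Neg _ | Or _ _ => false
  end.

(* The empty disjunction is Bot; a one-element disjunction is its element. *)
Fixpoint disj (N : nat) (P : Type) (s : seq (form N P)) : form N P :=
  match s with
  | [::] => Bot
  | [:: phi] => phi
  | phi :: s' => Or phi (disj s')
  end.

Definition clause (N : nat) (P : Type) (nabla : seq 'I_N)
    (neg pos : seq (form N P)) : form N P :=
  foldr (@Box N P) (disj (map (@Neg N P) neg ++ pos)) nabla.

(* Clausal forms whose clauses all have a number of literals n + m allowed
   by b. *)
Inductive clausal (N : nat) (P : Type) (b : pred nat) : form N P -> Prop :=
| clausal_pos l : poslit l -> clausal b l
| clausal_neg l : poslit l -> clausal b (Neg l)
| clausal_clause nabla neg pos :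
    all (@poslit N P) neg -> all (@poslit N P) pos ->
    b (size neg + size pos) -> clausal b (clause nabla neg pos)
| clausal_and phi psi : clausal b phi -> clausal b psi ->
    clausal b (And phi psi).

(* A logic over N modalities and the alphabet P is a set of formulas. *)
Definition logic (N : nat) (P : Type) : Type := form N P -> Prop.

Definition K_Bool (N : nat) (P : Type) : logic N P := fun _ => True.

Definition K_Krom (N : nat) (P : Type) : logic N P :=
  clausal (fun k => k <= 2).

(* Goedel numbering; the letters are numbered by the countType structure. *)
Fixpoint code (N : nat) (P : countType) (phi : form N P) : nat :=
  match phi with
  | Top => CodeSeq.code [:: 0]
  | Var p => CodeSeq.code [:: 1; pickle p]
  | Neg psi => CodeSeq.code [:: 2; code psi]
  | Or psi1 psi2 => CodeSeq.code [:: 3; code psi1; code psi2]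
  | Dia a psi => CodeSeq.code [:: 4; nat_of_ord a; code psi]
  | Box a psi => CodeSeq.code [:: 5; nat_of_ord a; code psi]
  end.

Lemma code_inj (N : nat) (P : countType) : injective (@code N P).
Proof.
have ci := can_inj CodeSeq.codeK.
elim=> [|p|f IH|f IHf g IHg|a f IH|a f IH] [|q|f'|f' g'|a' f'|a' f'] H;
  move: (ci _ _ H) => // -[].
- by move/(pcan_inj pickleK) ->.
- by move/IH ->.
- by move=> /IHf -> /IHg ->.
- by move=> /ord_inj -> /IH ->.
- by move=> /ord_inj -> /IH ->.
Qed.

(* tr is computable, as a map on codes, on the formulas of L. *)
Definition effective (N : nat) (P : countType) (L : logic N P)
    (tr : form N P -> form N P) : Prop :=
  exists f : murec 1, forall phi, L phi ->
    murec_eval f [tuple code phi] (code (tr phi)).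

Definition wle (N : nat) (P : countType) (L L' : logic N P) : Prop :=
  exists tr : form N P -> form N P,
    [/\ effective L tr,
        forall phi, L phi -> L' (tr phi) &
        forall phi, L phi -> forall (M : model N P) (w : world M),
          sat w phi <-> sat w (tr phi)].

Definition wequiv (N : nat) (P : countType) (L L' : logic N P) : Prop :=
  wle L L' /\ wle L' L.

Definition wlt (N : nat) (P : countType) (L L' : logic N P) : Prop :=
  wle L L' /\ ~ wequiv L L'.

(* Main.v *)
Require Import Defs.
From mathcomp Require Import all_boot.

Set Implicit Arguments.
Unset Strict Implicit.
Unset Printing Implicit Defensive.

(** In the model below every positive literal is either true at all worlds or
    has different truth values at [dead] and [loop]. Hence, for worlds that
    see both, the remaining successors do not influence the truth of positive
    literals, so every clausal formula true at [big] is true at [small], for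
    clauses of any size. But only [big] sees [step], which is the only world
    that has a successor but no path of length two starting from it. *)

Inductive wd := dead | loop | step | small | big.

Definition arrow (x y : wd) : Prop :=
  match x, y with
  | loop, (dead | loop) | step, dead
  | small, (dead | loop) | big, (dead | loop | step) => True
  | _, _ => False
  end.

(** Letters hold at [dead] alone, so each separates [dead] from [loop] while [small] and [big] agree
    on it. *)
Definition separating_model (N : nat) (P : Type) : model N P :=
  @Model N P wd (inhabits dead) (fun _ => arrow) (fun x _ => x = dead).

Definition holds (N : nat) (P : Type) (x : wd) (phi : form N P) : Prop :=
  @sat N P (separating_model N P) x phi.

Lemma sat_disj_cons (N : nat) (P : Type) (M : model N P) (w : world M)
    (phi : form N P) (s : seq (form N P)) :
  sat w (disj (phi :: s)) <-> sat w phi \/ sat w (disj s).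
Proof. by case: s => //=; split=> [|[|/(_ I)]] //; left. Qed.

Lemma sat_disj_mono (N : nat) (P : Type) (M : model N P) (x y : world M)
    (neg pos : seq (form N P)) :
  (forall l, poslit l -> sat x l <-> sat y l) ->
  all (@poslit N P) neg -> all (@poslit N P) pos ->
  sat x (disj (map (@Neg N P) neg ++ pos)) ->
  sat y (disj (map (@Neg N P) neg ++ pos)).
Proof.
move=> xy; elim: neg => [_|l neg IH /andP[/xy ll /IH{}IH] /IH{}IH].
  elim: pos => [//|l pos IH /andP[/xy ll /IH{}IH]].
  by move=> /sat_disj_cons H; apply/sat_disj_cons;
    case: H => [/ll|/IH]; [left|right].
rewrite map_cons cat_cons => /sat_disj_cons H; apply/sat_disj_cons.
by case: H => [H|/IH]; [left=> /ll|right].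
Qed.

Lemma poslit_dead_loop (N : nat) (P : Type) (l : form N P) : poslit l ->
  [\/ forall x, holds x l, holds dead l /\ ~ holds loop l
    | ~ holds dead l /\ holds loop l].
Proof.
elim: l => [|p|//|//|a l IH|a l IH] /= lit_l.
- by constructor 1.
- by constructor 2.
(* A diamond fails at [dead], which has no successor, and holds at [loop], which sees a world
   satisfying [l]. *)
- constructor 3; split; first by case=> [[]] [].
  by case: (IH lit_l) => [H|[H _]|[_ H]];
    [exists dead | exists dead | exists loop]; split=> //; exact: H.
(* A box is vacuous at [dead]; it fails at [loop] once [l] fails at [dead] or [loop]. *)
- case: (IH lit_l) => [H|[_ H]|[H _]].
  + by constructor 1=> x y _; exact: H.
  + by constructor 2; split=> [[]//|/(_ loop I)].
  + by constructor 2; split=> [[]//|/(_ dead I)].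
Qed.

Lemma poslit_big_small (N : nat) (P : Type) (l : form N P) : poslit l ->
  holds big l <-> holds small l.
Proof.
case: l => [|p|//|//|a l|a l] //= lit_l.
- split=> [[x [bx lx]]|[x [sx lx]]]; last by exists x; case: x sx lx.
  (* [small] sees both [dead] and [loop], and [l] holds at one of them. *)
  case: (poslit_dead_loop lit_l) => [H|[H _]|[_ H]];
    [exists dead | exists dead | exists loop]; split=> //; exact: H.
- split=> H x xx; first by apply: H; case: x xx.
  (* If [l] is not true everywhere, it fails at [dead] or [loop], against [H]. *)
  case: (poslit_dead_loop lit_l) => [|[_ nl]|[nl _]]; first exact.
  + by case: nl; exact: H.
  + by case: nl; exact: H.
Qed.

Lemma clausal_big_small (N : nat) (P : Type) (b : pred nat) (phi : form N P) :
  clausal b phi -> holds big phi -> holds small phi.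
Proof.
elim=> {phi} [l /poslit_big_small[]//|l /poslit_big_small ll bl /ll//
  |nabla neg pos hneg hpos _|phi psi _ IHphi _ IHpsi].
- case: nabla => [|a nabla] H.
    exact: sat_disj_mono (@poslit_big_small N P) hneg hpos H.
  (* Every successor of [small] is one of [big]. *)
  by move=> x sx; apply: H; case: x sx.
- by move=> H [nphi|npsi]; apply: H; [left=> /IHphi|right=> /IHpsi].
Qed.

Definition sees_step (N : nat) (P : Type) (a : 'I_N) : form N P :=
  Dia a (And (Dia a Top) (Box a (Box a Bot))).

Lemma big_sees_step (N : nat) (P : Type) (a : 'I_N) :
  holds big (@sees_step N P a).
Proof.
exists step; split=> //=; case=> [[]|]; first by exists dead.
by apply=> -[] // _ [].
Qed.

Lemma small_sees_step (N : nat) (P : Type) (a : 'I_N) :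
  ~ holds small (@sees_step N P a).
Proof.
(* Neither successor of [small] qualifies: [dead] sees nothing, and [loop] can be repeated. *)
case=> -[] [[]]; apply.
- by left=> -[[] []].
- by right=> /(_ loop I loop I); apply.
Qed.

(** The identity translates, computed on codes by a projection. *)
Lemma wle_sub (N : nat) (P : countType) (L L' : logic N P) :
  (forall phi, L phi -> L' phi) -> wle L L'.
Proof.
move=> LL'; exists id; split=> //.
by exists (RProj ord0) => phi _; exact: (EProj ord0 [tuple code phi]).
Qed.

Theorem theorem2 (N : nat) (P : countType) (hN : 0 < N) :
  wlt (@K_Krom N P) (@K_Bool N P).
Proof.
split; first exact: wle_sub.
case=> _ [tr [_ krom_tr sat_tr]].
(* The translation of [phi] would be clausal and true at [big], hence at [small], forcing [phi]
   there. *)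
pose phi := @sees_step N P (Ordinal hN).
apply: (@small_sees_step N P (Ordinal hN)).
apply/(sat_tr phi I (separating_model N P)).
apply: (clausal_big_small (krom_tr phi I)).
exact/(sat_tr phi I (separating_model N P) big)/big_sees_step.
Qed.
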